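(* If $G\in\mathcal S$, then for every $\varepsilon>0$ and every potential function $\rho:V(G)\to\{3,4,6\}$ on $G$, $(G,\rho)$ is not $\varepsilon$-flexible.
   Context: The family $\mathcal S$. A diamond is the graph obtained from $K_4$ by deleting an edge. A diamond is a diamond chain; furthermore, every graph obtained by identifying a degree-$2$ vertex of a diamond with a degree-$2$ vertex of a (disjoint) diamond chain is a diamond chain. (Every diamond chain has exactly two vertices of degree $2$.) $\mathcal S$ is the family of simple graphs $G$ obtained as follows. Begin with a cycle $v_1\ldots v_{2m+1}v_1$, $m\ge1$. For each odd $j\in\{1,\dots,2m-1\}$, let $D_j$ be a diamond chain (the $D_j$ disjoint from each other and from the cycle), identify one of the degree-$2$ vertices of $D_j$ with $v_j$, let $w_j$ be the second degree-$2$ vertex of $D_j$, and add an edge $w_jv_{j+1}$ (all cycle edges are kept). Covers. A DP $3$-cover $(H,L)$ of a (multi)graph $G$ is a graph $H$ together with pairwise disjoint sets $L(v)$, $v\in V(G)$, with union $V(H)$, such that each $L(v)$ is a clique of size $3$ in $H$, and for each pair $\{x,y\}$ of distinct vertices of $G$ joined by exactly $s\ge0$ edges, the set of edges of $H$ between $L(x)$ and $L(y)$ is the union of at most $s$ matchings. Each $L(v)$ is a pointed set: it comes with a distinguished basepoint $\omega(v)\in L(v)$, which is part of the data of the cover. If $L'(v)\subseteq L(v)$ for each $v$, an $(H,L')$-coloring of $G$ is a map $\varphi:V(G)\to V(H)$ with $\varphi(v)\in L'(v)$ for all $v$ and whose image is an independent set of $H$. Potential functions. A potential function is a map $\rho:V(G)\to\{3,4,6\}$.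 It defines $h_\rho(v)=2$ if $\rho(v)=3$ and $h_\rho(v)=3$ if $\rho(v)\in\{4,6\}$. List distributions. An $h_\rho$-list assignment assigns to each $v\in V(G)$ a set $L'(v)\subseteq L(v)$ of size $h_\rho(v)$. A list distribution $\mathcal D$ on $(G,\rho,H,L)$ is a probability distribution on $h_\rho$-list assignments; its random outcome is denoted $L_{\mathcal D}$. For a real $\varepsilon\in(0,1)$, it is $\varepsilon$-admissible if for each $v$ with $h_\rho(v)=2$ and each $c\in L(v)$, $\Pr(L(v)\setminus L_{\mathcal D}(v)=\{c\})\ge\varepsilon$. Coloring distributions. A coloring distribution $\Phi$ on $(G,\rho,H,L,\mathcal D)$ assigns to each outcome $L_{\mathcal D}$ of $\mathcal D$ a probability distribution on $(H,L_{\mathcal D})$-colorings of $G$; together with $\mathcal D$ it gives a joint distribution on pairs $(L_{\mathcal D},\phi)$ with first marginal $\mathcal D$ and with $\phi$ an $(H,L_{\mathcal D})$-coloring, and hence a random $(H,L)$-coloring $\phi$ of $G$. $\Phi$ is an $\varepsilon$-distribution if, with probabilities taken with respect to the overall joint distribution, for every $v\in V(G)$: (i) $\Pr(\phi(v)=c)\ge\varepsilon$ for each $c\in L(v)$; and (ii) if $\rho(v)=4$, then $\Pr(\phi(v)=\omega(v))=2\varepsilon$ and $\Pr(\phi(v)=c)=\frac12-\varepsilon$ for each $c\in L(v)\setminus\{\omega(v)\}$. Flexibility. $(G,\rho,H,L,\mathcal D)$ is $\varepsilon$-flexible if it has an $\varepsilon$-distribution. $(G,\rho)$ is $\varepsilon$-flexible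 if $(G,\rho,H,L,\mathcal D)$ is $\varepsilon$-flexible for every DP $3$-cover $(H,L)$ of $G$ (with every choice of basepoints) and every $\varepsilon$-admissible list distribution $\mathcal D$ on $(G,\rho,H,L)$.
   Formalization: The formal theorem assumes ε ≤ 1/3 whenever some vertex has ρ(v) = 3; for larger ε no ε-admissible list distribution exists, so (G,ρ) is vacuously ε-flexible and the claim as written fails exactly there. *)

(* Defs.v *)
From mathcomp Require Import all_boot all_order all_algebra.
From mathcomp Require Import reals.
Set Implicit Arguments.
Unset Strict Implicit.
Unset Printing Implicit Defensive.
Import Order.TTheory GRing.Theory Num.Theory.
Local Open Scope ring_scope.

Record sgraph := SGraph {
  svertex :> finType;
  adj : rel svertex;
  adj_sym : symmetric adj;
  adj_irrefl : irreflexive adj }.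

Definition degree (G : sgraph) (v : G) : nat := #|[set u | adj v u]|.

Record multigraph := MultiGraph {
  mvertex :> finType;
  mult : mvertex -> mvertex -> nat;
  mult_sym : forall u v, mult u v = mult v u;
  mult_loopless : forall v, mult v v = 0%N }.

Section MultiOfSimple.
Variable G : sgraph.
Let smult (u v : G) : nat := adj u v.
Fact smult_sym u v : smult u v = smult v u.
Proof. by rewrite /smult adj_sym. Qed.
Fact smult_loopless v : smult v v = 0%N.
Proof. by rewrite /smult adj_irrefl. Qed.
Definition multi_of_simple : multigraph := MultiGraph smult_sym smult_loopless.
End MultiOfSimple.

Definition is_diamond (G : sgraph) : Prop :=
  #|G| = 4%N /\
  exists x y : G, x != y /\
    forall u v, adj u v = (u != v) && ([set u; v] != [set x; y]).

(* G is, up to isomorphism, the disjoint union of A and B with the vertices  *)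
(* x and y identified: f and g are the inclusions of A and B in G.           *)
Definition identification (A B : sgraph) (x : A) (y : B) (G : sgraph) : Prop :=
  exists (f : A -> G) (g : B -> G),
  [/\ injective f,
      injective g,
      forall a b, f a = g b <-> a = x /\ b = y,
      forall p, (exists a, p = f a) \/ (exists b, p = g b)
    & forall p q, adj p q <->
          (exists a a', [/\ p = f a, q = f a' & adj a a'])
       \/ (exists b b', [/\ p = g b, q = g b' & adj b b'])].

Inductive diamond_chain : sgraph -> Prop :=
| diamond_chain1 (G : sgraph) : is_diamond G -> diamond_chain G
| diamond_chainS (A B : sgraph) (x : A) (y : B) (G : sgraph) :
    is_diamond A -> diamond_chain B ->
    degree x = 2%N -> degree y = 2%N ->
    identification x y G -> diamond_chain G.

(* The cycle v_1 ... v_(2m+1) is indexed from 0: k : 'I_(2m+1) stands for    *)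
(* v_(k+1). The chain attached at v_j, for j = 2i+1, is D i with i < m; its  *)
(* degree-2 vertices are a i, identified with v_j, and w i. The maps c and f *)
(* are the inclusions of the cycle and of the chains in G, so that this      *)
(* describes the construction up to isomorphism.                             *)
Definition in_calS (G : sgraph) : Prop :=
  exists (m : nat) (D : 'I_m -> sgraph) (a w : forall i, D i)
         (c : 'I_(m.*2).+1 -> G) (f : forall i, D i -> G),
  let odd_vtx (i : 'I_m) : 'I_(m.*2).+1 := inord i.*2 in
  let even_vtx (i : 'I_m) : 'I_(m.*2).+1 := inord i.*2.+1 in
  (0 < m)%N /\
  (forall i, [/\ diamond_chain (D i), degree (a i) = 2%N,
                 degree (w i) = 2%N & a i != w i]) /\
  [/\ injective c,
      forall i, injective (@f i),
      forall i x k, f i x = c k <-> x = a i /\ k = odd_vtx i,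
      forall i i' x x', f i x = f i' x' -> i = i'
    & forall p, (exists k, p = c k) \/ (exists i x, p = f i x)] /\
  (forall p q, adj p q <->
     [\/ exists k, (p = c k /\ q = c (ordS k)) \/ (q = c k /\ p = c (ordS k)),
         exists i (x y : D i), [/\ p = f i x, q = f i y & adj x y]
       | exists i, (p = f i (w i) /\ q = c (even_vtx i))
                \/ (q = f i (w i) /\ p = c (even_vtx i))]).

(* A set of edges between two disjoint sets, each edge being written as a    *)
(* pair with its end in the first set first.                                 *)
Definition matching (T : finType) (M : {set T * T}) : Prop :=
  forall p q, p \in M -> q \in M -> p.1 = q.1 \/ p.2 = q.2 -> p = q.

(* In dp_edges some of the matchings may be empty, hence "at most mult u v". *)
Record dp3_cover (G : multigraph) (H : sgraph) := DP3Cover {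
  dp_list :> G -> {set H};
  dp_base : G -> H;
  dp_disjoint : forall u v, u != v -> [disjoint dp_list u & dp_list v];
  dp_union : \bigcup_v dp_list v = [set: H];
  dp_card : forall v, #|dp_list v| = 3%N;
  dp_clique : forall v x y,
    x \in dp_list v -> y \in dp_list v -> x != y -> adj x y;
  dp_edges : forall u v, u != v ->
    exists M : 'I_(mult u v) -> {set H * H},
      (forall i, matching (M i)) /\
      [set p in setX (dp_list u) (dp_list v) | adj p.1 p.2] = \bigcup_i M i;
  dp_baseP : forall v, dp_base v \in dp_list v }.

Definition is_coloring (G : multigraph) (H : sgraph)
    (L' : G -> {set H}) (phi : G -> H) : Prop :=
  (forall v, phi v \in L' v) /\ (forall u v, ~~ adj (phi u) (phi v)).

Definition potential (G : multigraph) (rho : G -> nat) : Prop :=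
  forall v, rho v \in [:: 3; 4; 6]%N.

Definition hrho (G : multigraph) (rho : G -> nat) (v : G) : nat :=
  if rho v == 3%N then 2%N else 3%N.

Record fdist (R : realType) (T : finType) := FDist {
  pmf :> T -> R;
  pmf_ge0 : forall t, 0 <= pmf t;
  pmf_sum1 : \sum_t pmf t = 1 }.

Definition Pr (R : realType) (T : finType) (d : fdist R T) (A : pred T) : R :=
  \sum_(t | A t) d t.

Definition h_assignment (G : multigraph) (rho : G -> nat) (H : sgraph)
    (L : dp3_cover G H) (L' : {ffun G -> {set H}}) : bool :=
  [forall v, (L' v \subset L v) && (#|L' v| == hrho rho v)].

Definition assignment (G : multigraph) (rho : G -> nat) (H : sgraph)
    (L : dp3_cover G H) : finType :=
  {L' : {ffun G -> {set H}} | h_assignment rho L L'}.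

Definition list_distribution (R : realType) (G : multigraph) (rho : G -> nat)
    (H : sgraph) (L : dp3_cover G H) : Type :=
  fdist R (assignment rho L).

(* For v with hrho rho v = 2 the events for the three colors c in L v are    *)
(* disjoint, so such a v makes admissibility impossible when eps > 1/3.      *)
Definition admissible (R : realType) (eps : R) (G : multigraph)
    (rho : G -> nat) (H : sgraph) (L : dp3_cover G H)
    (D : list_distribution R rho L) : Prop :=
  forall v, hrho rho v = 2%N -> forall c, c \in L v ->
    eps <= Pr D [pred L' : assignment rho L | L v :\: val L' v == [set c]].

(* The distribution attached to an assignment of probability 0 is irrelevant *)
(* and left unconstrained; only outcomes of D need colorings.                *)
Record coloring_distribution (R : realType) (G : multigraph) (rho : G -> nat)
    (H : sgraph) (L : dp3_cover G H) (D : list_distribution R rho L) :=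
  ColoringDistribution {
    cdist :> assignment rho L -> fdist R {ffun G -> H};
    cdistP : forall L' phi,
      0 < D L' -> 0 < cdist L' phi -> is_coloring (val L') phi }.

Definition color_prob (R : realType) (G : multigraph) (rho : G -> nat)
    (H : sgraph) (L : dp3_cover G H) (D : list_distribution R rho L)
    (Phi : coloring_distribution D) (v : G) (c : H) : R :=
  \sum_L' D L' * Pr (Phi L') [pred phi : {ffun G -> H} | phi v == c].

Definition eps_distribution (R : realType) (eps : R) (G : multigraph)
    (rho : G -> nat) (H : sgraph) (L : dp3_cover G H)
    (D : list_distribution R rho L) (Phi : coloring_distribution D) : Prop :=
  forall v,
    (forall c, c \in L v -> eps <= color_prob Phi v c) /\
    (rho v = 4%N ->
       color_prob Phi v (dp_base L v) = 2 * eps /\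
       (forall c, c \in L v -> c != dp_base L v ->
          color_prob Phi v c = 2^-1 - eps)).

Definition flexible (R : realType) (eps : R) (G : multigraph)
    (rho : G -> nat) : Prop :=
  forall (H : sgraph) (L : dp3_cover G H) (D : list_distribution R rho L),
    admissible eps D ->
    exists Phi : coloring_distribution D, eps_distribution eps Phi.

(* Main.v *)
Require Import Defs.
From mathcomp Require Import all_boot all_order all_algebra.
From mathcomp Require Import perm reals.
Local Open Scope ring_scope.

(** In the cover whose matchings are all identities, except that each matching
    on an edge [w_j v_(j+1)] is the transposition (0 1), every proper coloring
    gives the two ends of a diamond chain the same color.  Hence if [v_j] has
    color 0 or 1, then [v_(j+1)], which is joined to both [v_j] and [w_j], must
    have color 2, and [v_(j+2)] again has color 0 or 1.  If [v_(2m+1)] had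
    color 2, then [v_1] would have color 0 or 1, and going around the cycle so
    would [v_(2m+1)].  So color 2 is never used at [v_(2m+1)], whatever the
    lists are. *)

Set Implicit Arguments.
Unset Strict Implicit.
Unset Printing Implicit Defensive.
Import Order.TTheory GRing.Theory Num.Theory.

Definition proper_coloring (G : sgraph) (C : eqType) (col : G -> C) : Prop :=
  forall u v, adj u v -> col u != col v.

(** * Three-colorings of diamond chains *)

(** The two vertices of degree 3 are adjacent and use two colors; a vertex of degree 2 is adjacent
    to both, so only the third color is left for it. *)
Lemma diamond_coloring (G : sgraph) (col : G -> 'I_3) (p q : G) :
  is_diamond G -> proper_coloring col ->
  degree p = 2%N -> degree q = 2%N -> col p = col q.
Proof.
move=> [cG [x [y [nxy adjE]]]] colP.
have card_xy : #|~: [set x; y]| = 2%N.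
  by have := cardsC [set x; y]; rewrite cards2 nxy cG => -[].
(* A vertex outside [[set x; y]] is adjacent to the three others, so its degree is 3. *)
have deg2 r : degree r = 2%N -> r \in [set x; y].
  apply: contra_eqT => rNxy.
  have -> : degree r = #|[set~ r]|.
    apply: eq_card => u; rewrite !inE adjE eq_sym andb_idr // => _.
    by apply: contra rNxy => /eqP <-; rewrite !inE eqxx.
  by have := cardsC1 r; rewrite cG => ->.
have /cards2P[z [t [nzt Ezt]]] := introT eqP card_xy.
have zN : z \notin [set x; y] by rewrite -in_setC Ezt !inE eqxx.
have tN : t \notin [set x; y] by rewrite -in_setC Ezt !inE eqxx orbT.
have adjN r s : s \notin [set x; y] -> r != s -> adj r s.
  by move=> sN rs; rewrite adjE rs; apply: contra sN => /eqP <-;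
     rewrite !inE eqxx orbT.
have neq r s : r \in [set x; y] -> s \notin [set x; y] -> r != s.
  by move=> rI; apply: contra => /eqP <-.
have colE r s : r \in [set x; y] -> s \in [set x; y] -> col r = col s.
  move=> rI sI; apply/val_inj/eqP.
  have := colP _ _ (adjN _ _ zN (neq _ _ rI zN)).
  have := colP _ _ (adjN _ _ tN (neq _ _ rI tN)).
  have := colP _ _ (adjN _ _ zN (neq _ _ sI zN)).
  have := colP _ _ (adjN _ _ tN (neq _ _ sI tN)).
  have := colP _ _ (adjN _ _ tN nzt).
  rewrite -!val_eqE /=.
  by case: (col r) (col s) (col z) (col t) => [[|[|[|?]]] ?] [[|[|[|?]]] ?]
     [[|[|[|?]]] ?] [[|[|[|?]]] ?].
by move=> /deg2 pI /deg2 qI; apply: colE.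
Qed.

Section Identification.
Variables (A B G : sgraph) (x : A) (y : B) (f : A -> G) (g : B -> G).
Hypothesis injf : injective f.
Hypothesis fgE : forall a b, f a = g b <-> a = x /\ b = y.
Hypothesis adjE : forall p q, adj p q <->
     (exists a a', [/\ p = f a, q = f a' & adj a a'])
  \/ (exists b b', [/\ p = g b, q = g b' & adj b b']).

(** Only [x] is shared with [B], so every edge of [G] at [f a] comes from [A]. *)
Lemma identification_degree (a : A) : a != x -> degree (f a) = degree a.
Proof.
move=> nax; rewrite /degree -(card_imset _ injf); apply: eq_card => q.
rewrite inE; apply/idP/imsetP => [/adjE[[a1 [a2 [E -> adj12]]]|] | [a' aa' ->]].
- by exists a2 => //; rewrite inE (injf E).
- by move=> [b [b' [/fgE[/eqP]]]]; rewrite (negPf nax).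
- by apply/adjE; left; exists a, a'; rewrite inE in aa'.
Qed.

End Identification.

Lemma diamond_chain_coloring (G : sgraph) (col : G -> 'I_3) (p q : G) :
  diamond_chain G -> proper_coloring col ->
  degree p = 2%N -> degree q = 2%N -> col p = col q.
Proof.
move=> chG; elim: chG col p q => {G}[G dG|A B x y G dA chB IH dx dy idG] col p q colP.
  exact: diamond_coloring.
case: idG => f [g [injf injg fgE surj adjE]].
have gfE b a : g b = f a <-> b = y /\ a = x.
  by split=> [/esym/fgE[-> ->] | [-> ->]] //; apply/esym/fgE.
have adjE' u v : adj u v <->
     (exists b b', [/\ u = g b, v = g b' & adj b b'])
  \/ (exists a a', [/\ u = f a, v = f a' & adj a a']).
  by rewrite adjE or_comm.
have colf : proper_coloring (col \o f).
  by move=> a a' aa'; apply: colP; apply/adjE; left; exists a, a'.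
have colg : proper_coloring (col \o g).
  by move=> b b' bb'; apply: colP; apply/adjE; right; exists b, b'.
have fgx : f x = g y by apply/fgE.
(* Every degree-2 vertex is compared with the glued vertex. Elsewhere degrees in the pieces agree
   with those in [G], so the diamond case or the induction hypothesis applies. *)
have col_shared r : degree r = 2%N -> col r = col (f x).
  case: (surj r) => [[a ->]|[b ->]] dr.
    apply: (diamond_coloring dA colf) => //.
    have [ax|nax] := eqVneq a x; first by rewrite ax.
    by rewrite -(identification_degree injf fgE adjE nax).
  rewrite fgx; apply: (IH _ b y colg) => //.
  have [by_|nby] := eqVneq b y; first by rewrite by_.
  by rewrite -(identification_degree injg gfE adjE' nby).
by move=> /col_shared -> /col_shared ->.
Qed.

(** * Covers with a permutation on each edge *)

Section GainCover.
Variables (G : sgraph) (s : G -> G -> 'I_3 -> 'I_3).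
Hypothesis sK : forall u v, cancel (s u v) (s v u).

(** The lift of a gain graph: vertices become triangles, and an edge [uv] becomes the perfect
    matching given by the permutation [s u v]; [sK] makes both orientations agree. *)
Definition gain_adj (p q : G * 'I_3) : bool :=
  if p.1 == q.1 then p.2 != q.2 else adj p.1 q.1 && (q.2 == s p.1 q.1 p.2).

Fact gain_adj_sym : symmetric gain_adj.
Proof.
move=> [u i] [v j]; rewrite /gain_adj /= [v == u]eq_sym [j == i]eq_sym.
case: ifP => // _; rewrite [adj v u]adj_sym; congr (_ && _).
by apply/eqP/eqP => ->; rewrite sK.
Qed.

Fact gain_adj_irrefl : irreflexive gain_adj.
Proof. by move=> p; rewrite /gain_adj !eqxx. Qed.

Definition gain_graph : sgraph := SGraph gain_adj_sym gain_adj_irrefl.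

Definition gain_list (v : multi_of_simple G) : {set gain_graph} :=
  [set p : G * 'I_3 | p.1 == v].

Definition gain_base (v : multi_of_simple G) : gain_graph := (v, ord0).

Fact gain_disjoint u v : u != v -> [disjoint gain_list u & gain_list v].
Proof.
move=> nuv; rewrite -setI_eq0 -subset0; apply/subsetP => p.
by rewrite !inE => /andP[/eqP ->]; rewrite (negPf nuv).
Qed.

Fact gain_union : \bigcup_v gain_list v = [set: gain_graph].
Proof. by apply/setP => p; rewrite inE; apply/bigcupP; exists p.1; rewrite ?inE. Qed.

Fact gain_card v : #|gain_list v| = 3%N.
Proof.
have -> : gain_list v = [set ((v, i) : G * 'I_3) | i : 'I_3].
  apply/setP => -[u i]; rewrite inE /=; apply/eqP/imsetP => [->|[j _ [->]]] //.
  by exists i.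
by rewrite card_imset ?card_ord // => i j [].
Qed.

Fact gain_clique v p q :
  p \in gain_list v -> q \in gain_list v -> p != q -> adj p q.
Proof.
case: p q => [u i] [w j]; rewrite !inE /= => /eqP -> /eqP -> npq.
by rewrite /adj /= /gain_adj /= eqxx; apply: contra npq => /eqP ->.
Qed.

Fact gain_edges u v : u != v ->
  exists M : 'I_(mult u v) -> {set gain_graph * gain_graph},
    (forall i, matching (M i)) /\
    [set p in setX (gain_list u) (gain_list v) | adj p.1 p.2] = \bigcup_i M i.
Proof.
move=> nuv; set E := [set p in _ | _].
have EP (p : gain_graph * gain_graph) : p \in E ->
    [/\ p.1.1 = u, p.2.1 = v, adj (u : G) (v : G)
       & p.2.2 = s u v p.1.2].
  rewrite !inE => /andP[/andP[/eqP p1 /eqP p2]].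
  by rewrite [adj _ _]/= /gain_adj p1 p2 (negPf nuv) => /andP[? /eqP].
(* [mult u v] is 0 or 1, so the family has at most one member; if it has none, [E] is empty too. *)
exists (fun=> E); split=> [_ [[p1 p2] [p3 p4]] [[q1 q2] [q3 q4]]|].
  move=> /EP[/= -> -> _ ->] /EP[/= -> -> _ ->] [[->]|[sE]] //.
  by rewrite (can_inj (sK u v) sE).
apply/setP => p; apply/idP/bigcupP => [pE|[]//].
have [_ _ uv _] := EP p pE.
have lt0 : (0 < mult u v)%N by rewrite /= uv.
by exists (Ordinal lt0).
Qed.

Fact gain_baseP v : gain_base v \in gain_list v.
Proof. by rewrite inE. Qed.

Definition gain_cover : dp3_cover (multi_of_simple G) gain_graph :=
  DP3Cover gain_disjoint gain_union gain_card gain_clique gain_edges gain_baseP.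

Lemma gain_coloring (L' : multi_of_simple G -> {set gain_graph})
    (phi : multi_of_simple G -> gain_graph) (u v : G) :
  (forall w, L' w \subset gain_cover w) -> is_coloring L' phi ->
  adj u v -> (phi v).2 != s u v (phi u).2.
Proof.
move=> subL [phiL phiN] uv.
have phi1 w : (phi w).1 = w by have /(subsetP (subL w)) := phiL w; rewrite inE => /eqP.
have := phiN u v; rewrite [adj _ _]/= /gain_adj !phi1 uv /=.
by case: eqP => // E; move: uv; rewrite E adj_irrefl.
Qed.

End GainCover.

(** * An admissible list distribution *)

Section UniformRemoval.
Variables (R : realType) (G : multigraph) (rho : G -> nat) (H : sgraph).
Variable L : dp3_cover G H.

Definition color (v : G) (k : 'I_3) : H := enum_val (cast_ord (esym (dp_card L v)) k).

(** The same index [k] is removed at all vertices of potential 3 at once: admissibility constrains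
    each vertex separately, so this correlation is harmless. *)
Definition removal_fun (k : 'I_3) : {ffun G -> {set H}} :=
  [ffun v => if rho v == 3%N then L v :\ color v k else L v].

Fact removal_funP k : h_assignment rho L (removal_fun k).
Proof.
apply/forallP => v; rewrite ffunE /hrho; case: ifP => _.
  rewrite subD1set; have := cardsD1 (color v k) (L v).
  by rewrite enum_valP dp_card => -[card2]; apply/eqP.
by rewrite subxx dp_card.
Qed.

Definition removal (k : 'I_3) : assignment rho L := Sub _ (removal_funP k).

(** Indicators are summed over [k] because the three removals coincide when no vertex has potential
    3. *)
Definition removal_pmf (L' : assignment rho L) : R :=
  \sum_k (L' == removal k)%:R * 3^-1.

Fact removal_pmf_ge0 L' : 0 <= removal_pmf L'.
Proof. by apply: sumr_ge0 => k _; rewrite mulr_ge0 ?ler0n // invr_ge0 ler0n. Qed.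

Fact removal_pmf_Pr (P : pred (assignment rho L)) :
  \sum_(L' | P L') removal_pmf L' = \sum_k (P (removal k))%:R * 3^-1.
Proof.
rewrite exchange_big /=; apply: eq_bigr => k _.
rewrite -mulr_suml; congr (_ * _).
rewrite big_mkcond (bigD1 (removal k)) //= eqxx big1 ?addr0; first by case: (P _).
by move=> L' /negPf ->; case: (P _).
Qed.

Fact removal_pmf_sum1 : \sum_L' removal_pmf L' = 1.
Proof. by rewrite removal_pmf_Pr sumr_const card_ord mul1r -[LHS]mulr_natr mulVf ?pnatr_eq0. Qed.

Definition uniform_removal : list_distribution R rho L :=
  FDist removal_pmf_ge0 removal_pmf_sum1.

(** Each color of [L v] has an index [k], whose removal alone contributes 1/3. *)
Lemma uniform_removal_admissible (eps : R) :
  (forall v, rho v = 3%N -> eps <= 3^-1) -> admissible eps uniform_removal.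
Proof.
move=> epsP v; rewrite /hrho; case: eqP => // rv _ x xL.
apply: le_trans (epsP v rv) _; rewrite /Pr removal_pmf_Pr.
pose k := cast_ord (dp_card L v) (enum_rank_in xL x).
have colk : color v k = x by rewrite /color cast_ordK enum_rankK_in.
rewrite (bigD1 k) //= ffunE rv eqxx colk setDDr setDv set0U.
rewrite (setIidPr _) ?sub1set // eqxx mul1r lerDl.
by apply: sumr_ge0 => i _; rewrite mulr_ge0 ?ler0n // invr_ge0 ler0n.
Qed.

End UniformRemoval.

(** Outcomes of mass 0 contribute nothing, and [cdistP] makes every other outcome a proper
    coloring. *)
Lemma color_prob_unused (R : realType) (G : multigraph) (rho : G -> nat)
    (H : sgraph) (L : dp3_cover G H) (D : list_distribution R rho L)
    (Phi : coloring_distribution D) (v : G) (x : H) :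
  (forall (L' : assignment rho L) phi,
     is_coloring (val L') phi -> phi v != x) ->
  color_prob Phi v x = 0.
Proof.
move=> unused; apply: big1 => L' _.
have [->|DL'] := eqVneq (D L') 0; first by rewrite mul0r.
rewrite /Pr big1 ?mulr0 // => phi /= /eqP phiv; apply/eqP/negPn/negP => Pphi.
have gt0 (T : finType) (d : fdist R T) t : d t != 0 -> 0 < d t.
  by rewrite lt_def pmf_ge0 andbT.
by have /negP[] := unused _ _ (cdistP (gt0 _ _ _ DL') (gt0 _ _ _ Pphi)); apply/eqP.
Qed.

(** With [uniform_removal] as list distribution, condition (i) at [x] would give [eps <= 0]. *)
Lemma not_flexible_of_unused_color (R : realType) (eps : R) (G : multigraph)
    (rho : G -> nat) (H : sgraph) (L : dp3_cover G H) (v : G) (x : H) :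
  0 < eps -> (forall u, rho u = 3%N -> eps <= 3^-1) -> x \in L v ->
  (forall (L' : G -> {set H}) phi,
     (forall u, L' u \subset L u) -> is_coloring L' phi -> phi v != x) ->
  ~ flexible eps rho.
Proof.
move=> eps0 epsP xL unused flex.
have [Phi /(_ v) [/(_ x xL) + _]] := flex H L _ (uniform_removal_admissible (L := L) epsP).
rewrite color_prob_unused ?leNgt ?eps0 // => L' phi; apply: unused => u.
by have /forallP/(_ u)/andP[] := valP L'.
Qed.

(** * The twisted cover of a graph in the family *)

(** As [x] is 0 or 1, [x] and its image under the transposition are 0 and 1 in some order, and [y]
    avoids both. *)
Lemma third_color (x y : 'I_3) :
  x != ord_max -> y != x -> y != tperm (inord 0) (inord 1) x -> y = ord_max.
Proof.
have val0 : @inord 2 0 = 0%N :> nat by rewrite inordK.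
have val1 : @inord 2 1 = 1%N :> nat by rewrite inordK.
move=> nx nyx nyt; apply/val_inj/eqP; move: nyt nx nyx.
case: tpermP => [->|->|/eqP x0 /eqP x1]; last move: x0 x1;
  rewrite -!val_eqE /= ?val0 ?val1; case: x y => [[|[|[|?]]] ?] [[|[|[|?]]] ?] //.
Qed.

Theorem mainTheorem5 (R : realType) (G : sgraph) (hG : in_calS G)
    (eps : R) (heps : 0 < eps)
    (rho : multi_of_simple G -> nat) (hrho : potential rho)
    (hadm : forall v, rho v = 3%N -> eps <= 3^-1) :
  ~ flexible eps rho.
Proof.
case: hG => m [D [a [w [c [f /= [_ [DP [[_ _ fcE _ _] adjE]]]]]]]].
(* Names follow the 1-based numbering: [ev i] has index 2i+1 and stands for v_(2i+2), [od i] for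
   v_(2i+1). *)
pose ev (i : 'I_m) : 'I_(m.*2).+1 := inord i.*2.+1.
pose od (i : 'I_m) : 'I_(m.*2).+1 := inord i.*2.
have evE i : ev i = i.*2.+1 :> nat by rewrite inordK // !ltnS ltn_double.
have odE i : od i = i.*2 :> nat by rewrite inordK // ltnS leq_double ltnW.
(* [tw] marks the edges carrying the transposition. It is symmetric and a transposition is an
   involution, whence [sK]. *)
pose tw (u v : G) := [exists i, (u == f i (w i)) && (v == c (ev i))
                             || (v == f i (w i)) && (u == c (ev i))].
have tw_sym u v : tw u v = tw v u by apply: eq_existsb => i; rewrite orbC.
pose s u v (k : 'I_3) := if tw u v then tperm (inord 0) (inord 1) k else k.
have sK u v : cancel (s u v) (s v u).
  by move=> k; rewrite /s tw_sym; case: (tw _ _) => //; rewrite tpermK.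
have cw i k : c k != f i (w i).
  apply/eqP => /esym/fcE[/eqP]; rewrite eq_sym.
  by case: (DP i) => _ _ _ /negPf ->.
(* Chains meet the cycle only at even indices, whereas [ev j] has odd index. *)
have fev i j (x : D i) : f i x != c (ev j).
  apply/eqP => /fcE[_ /(congr1 (fun k : 'I__ => odd k))].
  by rewrite evE -/(od i) odE /= !odd_double.
have tw_chain i (x y : D i) : tw (f i x) (f i y) = false.
  by apply/existsP => -[j]; rewrite !(negPf (fev _ _ _)) !andbF.
have tw_cycle k l : tw (c k) (c l) = false.
  by apply/existsP => -[j]; rewrite !(negPf (cw _ _)).
apply: (@not_flexible_of_unused_color _ _ _ _ _ (gain_cover sK)
          (c ord_max) (c ord_max, ord_max)) => //; first by rewrite inE.
move=> L' phi subL phiP; apply/eqP => phi_max.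
pose col v := (phi v).2.
have colP u v : adj u v -> col v != s u v (col u).
  exact: (gain_coloring subL phiP).
have col_cycle k : col (c (ordS k)) != col (c k).
  have /colP : adj (c k) (c (ordS k)) by apply/adjE; constructor 1; exists k; left.
  by rewrite /s tw_cycle.
have col_chain i : col (f i (w i)) = col (c (od i)).
  have -> : c (od i) = f i (a i) by apply/esym/fcE.
  case: (DP i) => chD da dw _.
  apply: (diamond_chain_coloring (col := col \o f i) chD) => // x y xy.
  have /colP : adj (f i x) (f i y) by apply/adjE; constructor 2; exists i, x, y.
  by rewrite /s tw_chain eq_sym.
have col_ev i : col (c (od i)) != ord_max -> col (c (ev i)) = ord_max.
  have /colP : adj (f i (w i)) (c (ev i)) by apply/adjE; constructor 3; exists i; left.
  have -> : s (f i (w i)) (c (ev i)) = tperm (inord 0) (inord 1).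
    rewrite /s; have -> // : tw (f i (w i)) (c (ev i)).
    by apply/existsP; exists i; rewrite !eqxx.
  rewrite col_chain => n3 n1; have := col_cycle (od i).
  have -> : ordS (od i) = ev i.
    by apply/val_inj; rewrite /= odE evE modn_small // !ltnS ltn_double.
  by move=> n2; apply: third_color n1 n2 n3.
have col_od n : (n <= m)%N -> col (c (inord n.*2)) != ord_max.
  elim: n => [_|n IH ltnm].
    (* [ordS] sends [ord_max] to 0: v_1 follows v_(2m+1), which has color 2. *)
    have := col_cycle ord_max; rewrite [X in _ != X]/col phi_max /=.
    by congr (col (c _) != _); apply/val_inj; rewrite /= modnn inordK.
  (* v_(2n+2) has color 2 by [col_ev], so the next cycle vertex v_(2n+3) avoids it. *)
  have /= /IH := ltnW ltnm; rewrite -[n]/(val (Ordinal ltnm)) => /col_ev <-.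
  rewrite doubleS; have := col_cycle (ev (Ordinal ltnm)).
  congr (col (c _) != _); apply/val_inj.
  have lt : (n.*2.+2 < (m.*2).+1)%N by rewrite -doubleS ltnS leq_double.
  by rewrite /= evE /= modn_small // inordK.
(* Index 2m is v_(2m+1) itself, assumed to have color 2. *)
have /negP[] := col_od m (leqnn m).
have -> : inord m.*2 = ord_max :> 'I_(m.*2).+1 by apply/val_inj; rewrite /= inordK.
by rewrite /col phi_max.
Qed.
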